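(* Let $d\ge 1$, $N\ge 1$, and $0\le i\le d$. Let $\boldsymbol{D}^i$ be the matrix of differentiation with respect to the $i$th barycentric coordinate $\lambda_i$ in the degree $N$ Bernstein basis on a $d$-simplex, with rows and columns indexed by the multi-indices $\boldsymbol{\alpha},\boldsymbol{\beta}\in\mathbb{Z}_{\ge 0}^{d+1}$ with $|\boldsymbol{\alpha}|=|\boldsymbol{\beta}|=N$. (a) For a fixed column $\boldsymbol{\beta}$, the non-zero row entries of $\boldsymbol{D}^i$ have indices $\boldsymbol{\alpha}$ such that $$\boldsymbol{D}^i_{\boldsymbol{\alpha},\boldsymbol{\beta}}=\alpha_j,\qquad \boldsymbol{\alpha}=\boldsymbol{\beta}-\boldsymbol{e}_i+\boldsymbol{e}_j,\qquad j=0,\ldots,d.$$ (b) For a fixed row $\boldsymbol{\alpha}$, the non-zero column entries of $\boldsymbol{D}^i$ have indices $\boldsymbol{\beta}$ such that $$\boldsymbol{D}^i_{\boldsymbol{\alpha},\boldsymbol{\beta}}=\alpha_j,\qquad \boldsymbol{\beta}=\boldsymbol{\alpha}+\boldsymbol{e}_i-\boldsymbol{e}_j,\qquad j=0,\ldots,d.$$ That is, for multi-indices $\boldsymbol{\alpha},\boldsymbol{\beta}$ of order $N$: if $\boldsymbol{\alpha}=\boldsymbol{\beta}-\boldsymbol{e}_i+\boldsymbol{e}_j$ for some $j\in\{0,\ldots,d\}$, then $\boldsymbol{D}^i_{\boldsymbol{\alpha},\boldsymbol{\beta}}=\alpha_j$; otherwise $\boldsymbol{D}^i_{\boldsymbo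l{\alpha},\boldsymbol{\beta}}=0$.
   Context: A multi-index is $\boldsymbol{\alpha}=(\alpha_0,\ldots,\alpha_d)\in\mathbb{Z}_{\ge0}^{d+1}$, with $|\boldsymbol{\alpha}|=\sum_{j=0}^d\alpha_j$; $\boldsymbol{e}_j$ is the $j$th canonical vector, $j=0,\ldots,d$. Let $\lambda_0,\ldots,\lambda_d$ be the barycentric coordinates of a nondegenerate $d$-simplex, so that $\lambda_0+\cdots+\lambda_d=1$. For $|\boldsymbol{\alpha}|=N$ the Bernstein polynomial of degree $N$ is $$B^N_{\boldsymbol{\alpha}}=\frac{N!}{\alpha_0!\cdots\alpha_d!}\lambda_0^{\alpha_0}\cdots\lambda_d^{\alpha_d}.$$ These form a basis of the polynomials of total degree at most $N$ on the simplex. The partial derivative $\partial B^N_{\boldsymbol{\beta}}/\partial\lambda_i$ is taken by treating $\lambda_0,\ldots,\lambda_d$ as independent variables in this formula; the result is then regarded as a polynomial on the simplex, i.e. restricted to $\lambda_0+\cdots+\lambda_d=1$. The matrix $\boldsymbol{D}^i$ is defined by $$\frac{\partial B^N_{\boldsymbol{\beta}}}{\partial\lambda_i}=\sum_{|\boldsymbol{\alpha}|=N}\boldsymbol{D}^i_{\boldsymbol{\alpha},\boldsymbol{\beta}}B^N_{\boldsymbol{\alpha}}\quad\text{on the simplex}.$$ Index vectors having a negative component are not multi-indices and do not correspond to any row or column. *)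

(* Defs.v *)
From HB Require Import structures.
From mathcomp Require Import all_boot all_order all_algebra.
From mathcomp Require Import mpoly.

Set Implicit Arguments.
Unset Strict Implicit.
Unset Printing Implicit Defensive.

Import Order.TTheory GRing.Theory Num.Theory.
Local Open Scope ring_scope.

(* The degree bound only serves to make this a finite type, over which one can
   sum. *)
Definition multiindex (d N : nat) : finType :=
  {a : 'X_{1..d.+1 < N.+1} | mdeg a == N}.

Definition exponents (d N : nat) (a : multiindex d N) : 'X_{1..d.+1} :=
  bmnm (val a).

(* Index arithmetic such as beta - e_i + e_j is done in Z^(d+1): a vector with
   a negative component is then not the image of any multi-index, whereas the
   subtraction on monomials is truncated. *)
Definition zvec (d N : nat) (a : multiindex d N) : 'rV[int]_d.+1 :=
  \row_j (exponents a j)%:Z.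

Definition unitvec (d : nat) (j : 'I_d.+1) : 'rV[int]_d.+1 := delta_mx 0 j.

Section Simplex.
Variables (R : realFieldType) (d : nat).
Implicit Types (v : 'I_d.+1 -> 'rV[R]_d) (x : 'rV[R]_d).

Definition affinely_independent v : Prop :=
  forall c : 'I_d.+1 -> R,
    \sum_j c j = 0 -> \sum_j c j *: v j = 0 -> forall j, c j = 0.

Definition in_simplex v x : Prop :=
  exists t : 'I_d.+1 -> R,
    [/\ forall j, 0 <= t j, \sum_j t j = 1 & \sum_j t j *: v j = x].

(* lam x j is the j-th barycentric coordinate of the point x. For affinely
   independent v there is exactly one such lam. *)
Definition barycentric v (lam : 'rV[R]_d -> 'I_d.+1 -> R) : Prop :=
  forall x, \sum_j lam x j = 1 /\ \sum_j lam x j *: v j = x.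

(* A polynomial in d+1 independent variables; the polynomial function on the
   simplex is obtained by evaluating the variables at the barycentric
   coordinates. *)
Definition bernstein (N : nat) (a : multiindex d N) : {mpoly R[d.+1]} :=
  (N`!%:R / \prod_(j < d.+1) (exponents a j)`!%:R) *: 'X_[exponents a].

Definition is_diff_matrix (N : nat) v (lam : 'rV[R]_d -> 'I_d.+1 -> R)
    (i : 'I_d.+1) (D : multiindex d N -> multiindex d N -> R) : Prop :=
  forall (b : multiindex d N) x, in_simplex v x ->
    ((bernstein b)^`M(i)).@[lam x]
      = \sum_(a : multiindex d N) D a b * (bernstein a).@[lam x].

End Simplex.

(* Main.v *)
Require Import Defs.
From HB Require Import structures.
From mathcomp Require Import all_boot all_order all_algebra.
From mathcomp Require Import mpoly.

Set Implicit Arguments.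
Unset Strict Implicit.
Unset Printing Implicit Defensive.

Import Order.TTheory GRing.Theory Num.Theory.
Local Open Scope ring_scope.

(** The Bernstein basis turns differentiation in a barycentric coordinate into
    a sparse operation.  If [b_i > 0] then, with [m = b - e_i],

      [d B^N_b / d lambda_i = N!/m! * lambda^m],

    which has degree [N - 1].  On the simplex nothing changes when it is
    multiplied by [1 = \sum_j lambda_j], which brings it back to degree [N]; the
    [j]-th term is then [N!/m! * lambda^(m + e_j) = a_j * B^N_a] with
    [a = m + e_j], because [a! = a_j * m!].  If [b_i = 0] the derivative
    vanishes, and so does the only announced entry of the column, [a_i = b_i]
    for [a = b].  So the matrix with the announced entries does represent the
    derivative ([bernstein_deriv_sum]).

    It is the only one, since the Bernstein polynomials are linearly
    independent as functions on the simplex ([bernstein_free]).  All of them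
    being homogeneous of the same degree, a relation on the simplex extends to
    the positive orthant by scaling.  Restricting it to the curve with
    coordinates [s ^ (M ^ j)], where [M = N + 1], sends distinct monomials to
    distinct powers of [s], as the exponents of a monomial are digits in base
    [M]; the relation becomes a polynomial identity in one variable. *)

(** * Index arithmetic *)

Lemma exponents_inj d N : injective (@exponents d N).
Proof. by move=> a b eq_ab; do 2!apply: val_inj. Qed.

Lemma mdeg_exponents d N (a : multiindex d N) : mdeg (exponents a) = N.
Proof. exact/eqP/(valP a). Qed.

Lemma exponents_surj d N (m : 'X_{1..d.+1}) :
  mdeg m = N -> exists a : multiindex d N, exponents a = m.
Proof.
move=> degm; have ltm : (mdeg m < N.+1)%N by rewrite degm.
have eqm : mdeg (BMultinom ltm) == N by rewrite /= degm.
by exists (exist _ (BMultinom ltm) eqm).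
Qed.

Lemma exponents_le d N (a : multiindex d N) j : (exponents a j <= N)%N.
Proof. by rewrite -[leqRHS](mdeg_exponents a) mdegE (bigD1 j) //= leq_addr. Qed.

Lemma subm1K n (m : 'X_{1..n}) i : (0 < m i)%N -> (m - U_(i) + U_(i))%MM = m.
Proof.
by move=> m_gt0; apply/submK/mnm_lepP => k; rewrite mnm1E; case: eqP => // <-.
Qed.

(** Moving the subtracted vector to the other side turns the index relation on
    integer vectors into one between monomials, free of truncation. *)
Lemma zvec_shiftE d N (a b : multiindex d N) i j :
  (zvec a == zvec b - unitvec i + unitvec j)
  = ((exponents a + U_(i))%MM == (exponents b + U_(j))%MM).
Proof.
rewrite -addrA (addrC (- _)) addrA -subr_eq opprK.
apply/eqP/eqP => [/rowP eq_ab | /mnmP eq_ab].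
  apply/mnmP => k; move: (eq_ab k); rewrite !mxE !mnmDE !mnm1E eqxx /=.
  by rewrite !(eq_sym k) !natz -!PoszD; case.
apply/rowP => k; move: (eq_ab k); rewrite !mnmDE !mnm1E !mxE eqxx /=.
by rewrite !(eq_sym k) !natz -!PoszD => ->.
Qed.

(** * Linear independence of the Bernstein polynomials on the simplex *)

Lemma digits_inj M n (f g : 'I_n -> nat) :
    (forall j, f j < M)%N -> (forall j, g j < M)%N ->
    (\sum_j f j * M ^ j = \sum_j g j * M ^ j)%N ->
  f =1 g.
Proof.
elim: n f g => [|n IHn] f g ltf ltg; first by move=> _ [].
have M_gt0 : (0 < M)%N by apply: leq_ltn_trans (ltf ord0).
have shift (h : 'I_n.+1 -> nat) :
    (\sum_j h j * M ^ j
     = (\sum_(j < n) h (lift ord0 j) * M ^ j) * M + h ord0)%N.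
  rewrite big_ord_recl expn0 muln1 addnC big_distrl /=; congr addn.
  by apply: eq_bigr => j _; rewrite expnSr mulnA.
rewrite !shift => eq_fg.
have eq0 : f ord0 = g ord0.
  by have := congr1 (modn^~ M) eq_fg; rewrite !modnMDl !modn_small.
have eqS := congr1 (divn^~ M) eq_fg.
rewrite !divnMDl // !divn_small // !addn0 in eqS.
have IH := IHn _ _ (fun j => ltf (lift ord0 j)) (fun j => ltg (lift ord0 j)) eqS.
by move=> j; case: (unliftP ord0 j) => [k|] ->; [apply: IH | apply: eq0].
Qed.

Lemma poly_eq0_pos (R : realFieldType) (q : {poly R}) :
  (forall s, 0 < s -> q.[s] = 0) -> q = 0.
Proof.
move=> q0; apply: (@roots_geq_poly_eq0 _ _ [seq k.+1%:R | k <- iota 0 (size q)]).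
- by apply/allP => _ /mapP[k _ ->]; rewrite /root q0 // ltr0Sn.
- rewrite map_inj_uniq ?iota_uniq // => j k /eqP.
  by rewrite eqr_nat eqSS => /eqP.
- by rewrite size_map size_iota.
Qed.

Section Bernstein.
Variables (R : realFieldType) (d N : nat).
Implicit Types (a b : multiindex d N) (t : 'I_d.+1 -> R) (m : 'X_{1..d.+1}).

Definition mfact m : nat := \prod_(j < d.+1) (m j)`!.

Lemma mfact_neq0 m : (mfact m)%:R != 0 :> R.
Proof.
by rewrite pnatr_eq0 -lt0n prodn_gt0 // => j; apply: fact_gt0.
Qed.

Lemma mfactD1 m j : mfact (m + U_(j))%MM = ((m j).+1 * mfact m)%N.
Proof.
rewrite /mfact (bigD1 j) //= [in RHS](bigD1 j) //= mulnA; congr muln.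
  by rewrite mnmDE mnm1E eqxx addn1 factS.
by apply: eq_bigr => k neq_kj; rewrite mnmDE mnm1E eq_sym (negPf neq_kj) addn0.
Qed.

Lemma bernsteinE a :
  bernstein R a = (N`!%:R / (mfact (exponents a))%:R) *: 'X_[exponents a].
Proof. by rewrite /bernstein /mfact natr_prod. Qed.

Lemma bernstein_scale a (s : R) t :
  (bernstein R a).@[fun j => s * t j] = s ^+ N * (bernstein R a).@[t].
Proof.
rewrite /bernstein !mevalZ !mevalX mulrCA; congr (_ * _).
under eq_bigr do rewrite exprMn.
by rewrite big_split /= prodrXr -mdegE mdeg_exponents.
Qed.

(** The points of the simplex used below are the normalisations of
    [(s, s ^ M, s ^ (M ^ 2), ...)] with [M = N + 1] and [s > 0]; the monomial of
    index [a] becomes [s ^ K a] there, and [K] is injective because no exponent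
    exceeds [N]. *)
Theorem bernstein_free (c : multiindex d N -> R) :
    (forall t, (forall j, 0 <= t j) -> \sum_j t j = 1 ->
       \sum_a c a * (bernstein R a).@[t] = 0) ->
  forall a, c a = 0.
Proof.
move=> c0.
pose K a := (\sum_j exponents a j * N.+1 ^ j)%N.
have K_inj : injective K.
  move=> a b eqK; apply/exponents_inj/mnmP.
  by apply: digits_inj eqK => j; rewrite ltnS exponents_le.
pose w a : R := N`!%:R / (mfact (exponents a))%:R.
have w_neq0 a : w a != 0.
  by rewrite mulf_neq0 ?invr_neq0 ?mfact_neq0 // pnatr_eq0 -lt0n fact_gt0.
pose q : {poly R} := \sum_a (c a * w a) *: 'X^(K a).
have q_eq0 : q = 0.
  apply: poly_eq0_pos => s s_gt0.
  pose u (j : 'I_d.+1) := s ^+ (N.+1 ^ j).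
  pose T := \sum_j u j.
  have u_ge0 j : 0 <= u j by rewrite exprn_ge0 // ltW.
  have T_gt0 : 0 < T.
    by rewrite /T (bigD1 ord0) //= ltr_pwDl ?exprn_gt0 // sumr_ge0.
  have T_neq0 := lt0r_neq0 T_gt0.
  have : \sum_a c a * (bernstein R a).@[fun j => T^-1 * u j] = 0.
    apply: c0 => [j|]; first by rewrite mulr_ge0 // invr_ge0 ltW.
    by rewrite -mulr_sumr mulVf.
  under eq_bigr do rewrite bernstein_scale mulrCA.
  rewrite -mulr_sumr => /eqP; rewrite mulf_eq0 expf_eq0 invr_eq0 (negPf T_neq0).
  rewrite andbF /= => /eqP qu0; rewrite -[RHS]qu0 /q horner_sum.
  apply: eq_bigr => a _; rewrite hornerZ hornerXn bernsteinE mevalZ mevalX -mulrA.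
  congr (_ * (_ * _)); rewrite /K -prodrXr; apply: eq_bigr => j _.
  by rewrite -exprM mulnC.
move=> a; have := congr1 (fun p : {poly R} => p`_(K a)) q_eq0.
rewrite coef0 /q coef_sum (bigD1 a) //= coefZ coefXn eqxx mulr1 big1 => [|b neq_ba].
  by rewrite addr0 => /eqP; rewrite mulf_eq0 (negPf (w_neq0 a)) orbF => /eqP.
by rewrite coefZ coefXn (inj_eq K_inj) eq_sym (negPf neq_ba) mulr0.
Qed.

(** * Degree elevation of the derivative *)

(** Both coefficients reduce to [N! / m!], where [m] is the common lower
    neighbour of [a] and [b]. *)
Lemma bernstein_neighbour a b i j :
    (0 < exponents b i)%N ->
    (exponents a + U_(i) = exponents b + U_(j))%MM ->
  (exponents a j)%:R *: bernstein R a = 'X_j * (bernstein R b)^`M(i).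
Proof.
move=> b_gt0 eq_ab; pose m := (exponents b - U_(i))%MM.
have def_b : exponents b = (m + U_(i))%MM by rewrite subm1K.
have def_a : exponents a = (m + U_(j))%MM.
  by apply: (@addIm _ U_(i)%MM); rewrite eq_ab def_b -!addmA (addmC U_(i)%MM).
have coefE k : (N`!%:R / (mfact (m + U_(k))%MM)%:R) * ((m + U_(k))%MM k)%:R
    = N`!%:R / (mfact m)%:R :> R.
  rewrite mfactD1 mnmDE mnm1E eqxx addn1 natrM invfM.
  by rewrite mulrA mulrAC divfK // pnatr_eq0.
rewrite !bernsteinE mderivZ mderivX !scalerA -scalerAr -mpolyXD.
rewrite def_a def_b addmK [(U_(j) + m)%MM]addmC; congr (_ *: _).
by rewrite coefE mulrC coefE.
Qed.

(** Summing over [j] avoids choosing the one, if any, that relates [a] to [b]. *)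
Definition diff_entry i a b : R :=
  \sum_(j | (exponents a + U_(i))%MM == (exponents b + U_(j))%MM)
     (exponents a j)%:R.

(** The sum has a single term, since [U_(j)] determines [j]. *)
Lemma diff_entry_shift i j a b :
  zvec a = zvec b - unitvec i + unitvec j ->
  diff_entry i a b = (exponents a j)%:R.
Proof.
move/eqP; rewrite zvec_shiftE => /eqP eq_ab; rewrite /diff_entry (big_pred1 j) //.
move=> k; rewrite eq_ab /= eqm_add2l.
apply/eqP/eqP => [/mnmP/(_ j)|-> //].
by rewrite !mnm1E eqxx; case: eqP.
Qed.

Lemma diff_entry_eq0 i a b :
  ~ (exists j, zvec a = zvec b - unitvec i + unitvec j) ->
  diff_entry i a b = 0.
Proof.
move=> no_j; rewrite /diff_entry big_pred0 // => j.
by apply/negP; rewrite -zvec_shiftE => /eqP ?; apply: no_j; exists j.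
Qed.

(** The sum has one term if [b i > 0].  If [b i = 0] the derivative is zero, and
    the sum, non-empty only when [i = j], consists of a zero term. *)
Lemma bernstein_elevate i j b :
  'X_j * (bernstein R b)^`M(i)
  = \sum_(a : multiindex d N
        | (exponents a + U_(i))%MM == (exponents b + U_(j))%MM)
      (exponents a j)%:R *: bernstein R a.
Proof.
have [b_i0|b_gt0] := posnP (exponents b i).
  rewrite bernsteinE mderivZ mderivX b_i0 scale0r scaler0 mulr0 big1 // => a.
  (* Comparing the [i]-th components forces [j = i] and [a i = 0]. *)
  move=> /eqP eq_ab; have := congr1 (fun m : 'X_{1..d.+1} => m i) eq_ab.
  rewrite !mnmDE !mnm1E eqxx b_i0 addn1 add0n; case: eqP => // -> [->].
  by rewrite scale0r.
have [a def_a] : exists a : multiindex d N,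
    exponents a = (exponents b - U_(i) + U_(j))%MM.
  apply: exponents_surj; rewrite mdegD mdeg1 -(mdeg1 i) -mdegD subm1K //.
  exact: mdeg_exponents.
have eq_ab : (exponents a + U_(i) = exponents b + U_(j))%MM.
  by rewrite def_a -addmA (addmC U_(j)%MM) addmA subm1K.
rewrite (big_pred1 a) => [|a' /=]; first by rewrite (bernstein_neighbour b_gt0).
by rewrite -eq_ab eqm_add2r (inj_eq (@exponents_inj _ _)).
Qed.

(** The hypothesis on [t] allows multiplying the derivative by [\sum_j t j]. *)
Lemma bernstein_deriv_sum i b t : \sum_j t j = 1 ->
  ((bernstein R b)^`M(i)).@[t]
  = \sum_a diff_entry i a b * (bernstein R a).@[t].
Proof.
move=> sum_t; rewrite -[LHS]mul1r -sum_t mulr_suml.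
under eq_bigr => j _.
  rewrite -[t j](mevalXU t) -mevalM bernstein_elevate raddf_sum /=.
  under eq_bigr do rewrite mevalZ.
  over.
rewrite (exchange_big_dep predT) //=.
by apply: eq_bigr => a _; rewrite mulr_suml.
Qed.

End Bernstein.

(** * Uniqueness of the differentiation matrix *)

Lemma barycentric_uniq (R : realFieldType) d (v : 'I_d.+1 -> 'rV[R]_d) lam
    (t : 'I_d.+1 -> R) :
    affinely_independent v -> barycentric v lam -> \sum_j t j = 1 ->
  lam (\sum_j t j *: v j) =1 t.
Proof.
move=> hv hlam sum_t j; have [sum_l sum_lv] := hlam (\sum_j t j *: v j).
apply/eqP; rewrite -subr_eq0; apply/eqP.
apply: (hv (fun k => lam (\sum_j t j *: v j) k - t k)).
  by rewrite sumrB sum_l sum_t subrr.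
by under eq_bigr do rewrite scalerBl; rewrite sumrB sum_lv subrr.
Qed.

(** Every [t] with non-negative entries of sum [1] is the coordinate vector of a
    point of the simplex, so [bernstein_free] applies to each column of the
    difference of the two matrices. *)
Lemma diff_matrix_uniq (R : realFieldType) d N (v : 'I_d.+1 -> 'rV[R]_d) lam i
    (D : multiindex d N -> multiindex d N -> R) :
    affinely_independent v -> barycentric v lam -> is_diff_matrix v lam i D ->
  forall a b, D a b = diff_entry R i a b.
Proof.
move=> hv hlam hD a b; apply/eqP; rewrite -subr_eq0; apply/eqP.
move: a; apply: bernstein_free => t t_ge0 sum_t.
have lam_t := barycentric_uniq hv hlam sum_t.
have := hD b _ (ex_intro _ t (And3 t_ge0 sum_t erefl)).
rewrite (meval_eq _ lam_t) (bernstein_deriv_sum _ _ sum_t) => eqD.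
under eq_bigr do rewrite mulrBl.
rewrite sumrB eqD; apply/eqP; rewrite subr_eq0; apply/eqP.
by apply: eq_bigr => a _; rewrite (meval_eq _ lam_t).
Qed.

Theorem lemmaA1 (R : realFieldType) (d N : nat) (hd : (1 <= d)%N)
    (hN : (1 <= N)%N)
    (v : 'I_d.+1 -> 'rV[R]_d) (hv : affinely_independent v)
    (lam : 'rV[R]_d -> 'I_d.+1 -> R) (hlam : barycentric v lam)
    (i : 'I_d.+1) (D : multiindex d N -> multiindex d N -> R)
    (hD : is_diff_matrix v lam i D) :
  (forall b a : multiindex d N,
     (forall j : 'I_d.+1,
        zvec a = zvec b - unitvec i + unitvec j ->
        D a b = (exponents a j)%:R) /\
     (~ (exists j : 'I_d.+1, zvec a = zvec b - unitvec i + unitvec j) ->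
        D a b = 0)) /\
  (forall a b : multiindex d N,
     (forall j : 'I_d.+1,
        zvec b = zvec a + unitvec i - unitvec j ->
        D a b = (exponents a j)%:R) /\
     (~ (exists j : 'I_d.+1, zvec b = zvec a + unitvec i - unitvec j) ->
        D a b = 0)).
Proof.
have defD := diff_matrix_uniq hv hlam hD.
have columns (b a : multiindex d N) :
    (forall j, zvec a = zvec b - unitvec i + unitvec j ->
       D a b = (exponents a j)%:R) /\
    (~ (exists j, zvec a = zvec b - unitvec i + unitvec j) -> D a b = 0).
  by rewrite defD; split=> [j|]; [apply: diff_entry_shift | apply: diff_entry_eq0].
split=> [|a b]; first exact: columns.
have [shift no_shift] := columns b a.
have rowE j : zvec b = zvec a + unitvec i - unitvec j <->
    zvec a = zvec b - unitvec i + unitvec j.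
  by split=> ->; [rewrite addrAC subrK addrK | rewrite addrAC addrK subrK].
by split=> [j /rowE/shift //|no_j]; apply: no_shift => -[j /rowE eq_ab];
  apply: no_j; exists j.
Qed.
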